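(* Let $A\geq a\geq 1$ and $r\geq 2$ be integers. Then \[ \sum_{\pi\in\overline{\mathcal{P}}}z^{\widetilde{mes}_{r,A,a}(\pi)} q^{|\pi|} =\frac{(-q;q)_{\infty }}{(q;q)_{\infty}}\sum_{k=0}^{\infty }z^{kA+a}\bigg[\frac{q^{A\binom{k}{2}+ka}}{(-q^{a};q^{A})_{k}}(-q^{(r-2)a};q^{(r-2)A})_{k}-\frac{q^{A\binom{k+1}{2}+(k+1)a}}{(-q^{a};q^{A})_{k+1}}(-q^{(r-2)a};q^{(r-2)A})_{k+1}\bigg]. \]
   Context: An overpartition is a partition (finite non-increasing sequence of positive integers) in which the first occurrence of each part value may be overlined; $\overline{\mathcal{P}}$ is the set of all overpartitions and $|\pi|$ the sum of parts. $(a;q)_\infty=\prod_{i\geq0}(1-aq^i)$, $(a;q)_n=\prod_{i=0}^{n-1}(1-aq^i)$ (so when $r=2$, $(-q^{0};q^{0})_k=2^k$); $|q|<1$, $z$ a formal variable. For $r\geq2$, $\widetilde{mes}_{r,A,a}(\pi)$ is the smallest positive integer $m\equiv a\pmod A$ such that $\pi$ has no overlined part $\overline{m}$ and $\pi$ has fewer than $r-1$ non-overlined parts equal to $m$. *)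

(* Defs.v *)
From HB Require Import structures.
From mathcomp Require Import all_boot all_order all_algebra.
From mathcomp Require Import boolp classical_sets functions reals topology.
From mathcomp Require Import normedtype sequences.
(* Not imported: its [sum] would hide the sum type. *)
From mathcomp Require summability.

Set Implicit Arguments.
Unset Strict Implicit.
Unset Printing Implicit Defensive.

Import Order.TTheory GRing.Theory Num.Theory.
Import numFieldNormedType.Exports.

Local Open Scope classical_set_scope.
Local Open Scope ring_scope.

(* [(m, true)] is the overlined part m, [(m, false)] the non-overlined one.
   The pairwise condition says that an overlined part differs in value from
   every earlier part, i.e., is the first occurrence of its value. *)
Definition is_overpartition (s : seq (nat * bool)) : bool :=
  [&& all [pred x | (0 < x.1)%N] s,
      sorted geq (unzip1 s)
    & pairwise [rel x y | y.2 ==> (x.1 != y.1)] s].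

Record overpartition := Overpartition {
  op_parts :> seq (nat * bool);
  _ : is_overpartition op_parts }.

HB.instance Definition _ := [isSub for op_parts].
HB.instance Definition _ := [Countable of overpartition by <:].

Definition weight (p : overpartition) : nat := (\sum_(x <- p) x.1)%N.

Definition mes_pred (r A a : nat) (p : overpartition) : pred nat :=
  fun m => [&& (0 < m)%N, m == a %[mod A],
               (m, true) \notin op_parts p
             & (count_mem (m, false) p < r.-1)%N].

(* The default value 0 is never used when 0 < A and 1 < r: see [mes_pred_ex]. *)
Definition mes (r A a : nat) (p : overpartition) : nat :=
  if pselect (exists m, mes_pred r A a p m) is left ex_m then ex_minn ex_m
  else 0%N.

Lemma mes_pred_ex r A a p : (0 < A)%N -> (1 < r)%N ->
  exists m, mes_pred r A a p m.
Proof.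
move=> A_gt0 r_gt1; exists ((weight p).+1 * A + a)%N.
have big b : (((weight p).+1 * A + a)%N, b) \notin op_parts p.
  apply/negP => mp; suff: ((weight p).+1 * A + a <= weight p)%N.
    by apply/negP; rewrite -ltnNge (leq_trans _ (leq_addr _ _)) // leq_pmulr.
  by rewrite [leqRHS]/weight (big_rem _ mp) /= leq_addr.
apply/and4P; split; rewrite ?big //.
- by rewrite addn_gt0 muln_gt0 A_gt0.
- by rewrite modnMDl.
- by rewrite (count_memPn (big false)); case: r r_gt1 => [|[]].
Qed.

Lemma mesP r A a p : (0 < A)%N -> (1 < r)%N ->
  mes_pred r A a p (mes r A a p) /\
  forall m, mes_pred r A a p m -> (mes r A a p <= m)%N.
Proof.
move=> A_gt0 r_gt1; rewrite /mes; case: pselect => [ex_m|[]].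
  by case: ex_minnP.
exact: mes_pred_ex.
Qed.

Section QPochhammer.
Context {K : numFieldType}.
Implicit Types x q : K.

Definition qpoch x q (n : nat) : K := \prod_(i < n) (1 - x * q ^+ i).

Definition qpoch_infty x q : K := lim (qpoch x q n @[n --> \oo]).

End QPochhammer.

(* Formal power series in z over K are represented by their coefficient
   sequences, and families of such series are summed coefficientwise; each
   coefficient is summed unconditionally, i.e., as a limit along the directed
   set of finite subsets of the index type. *)
Section ZSeries.
Context {K : numFieldType}.

Definition zmonom (c : K) (m : nat) : nat -> K :=
  fun n => if n == m then c else 0.

Definition zsummable (I : choiceType) (F : I -> nat -> K) : Prop :=
  forall n, cvg (summability.partial_sum (F ^~ n) @ summability.totally).

Definition zsum (I : choiceType) (F : I -> nat -> K) : nat -> K :=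
  fun n => lim (summability.partial_sum (F ^~ n) @ summability.totally).

Definition zscale (c : K) (f : nat -> K) : nat -> K := fun n => c * f n.

End ZSeries.

(* Main.v *)
(* Write F(P) for the sum of q^|p| over the overpartitions p satisfying P. If P
   does not look at parts equal to m, inserting a part m shows that the
   overpartitions satisfying P without (with) the overlined part m contribute
   F(P)/(1+q^m) (resp. q^m F(P)/(1+q^m)), and that requiring in addition j
   non-overlined copies of m multiplies the former by q^(jm). Hence m violates
   the condition defining mes with relative weight
   q^m (1 + q^((r-2)m)) / (1 + q^m), and these weights multiply along
   m = a, A+a, ..., (k-1)A+a; the coefficient of z^(kA+a) is a difference of two
   consecutive products. In the same way F(all parts > N) is
   F(all) (q;q)_N / (-q;q)_N, and it tends to 1, which gives the prefactor. *)
Require Import Defs.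
From HB Require Import structures.
From mathcomp Require Import all_boot all_order all_algebra.
From mathcomp Require Import finmap.
From mathcomp Require Import boolp classical_sets reals topology.
From mathcomp Require Import normedtype sequences exp.
From mathcomp Require Import complex.
From mathcomp Require Import zify ring lra.
From mathcomp Require summability.

Set Implicit Arguments.
Unset Strict Implicit.
Unset Printing Implicit Defensive.

Import Order.TTheory GRing.Theory Num.Theory.
Import numFieldNormedType.Exports.

Local Open Scope classical_set_scope.
Local Open Scope ring_scope.

#[local] Existing Instance summability.totally_filter.

(** * Unconditional sums *)

Section HasSum.
Context {K : numFieldType}.
Implicit Types (I : choiceType).

Definition has_sum I (f : I -> K) (s : K) : Prop :=
  summability.partial_sum f @ summability.totally --> s.

Lemma has_sumP I (f : I -> K) s :
  has_sum f s <->
  forall e : K, 0 < e -> exists J0 : {fset I}, forall J : {fset I},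
    (J0 `<=` J)%fset -> `|s - \sum_(i <- J) f i| < e.
Proof.
rewrite /has_sum; split=> [/cvgrPdist_lt fs e e0|fs].
  have [J0 _ J0P] := fs e e0; exists J0 => J /J0P /=.
  by rewrite /summability.partial_sum big_seq_fsetE.
apply/cvgrPdist_lt => e /fs[J0 J0P]; exists J0 => // J /J0P /=.
by rewrite /summability.partial_sum big_seq_fsetE.
Qed.

Lemma has_sum_cvg I (f : I -> K) s :
  has_sum f s -> cvg (summability.partial_sum f @ summability.totally).
Proof. by move=> fs; apply/cvg_ex; exists s. Qed.

Lemma has_sum_lim I (f : I -> K) s :
  has_sum f s -> lim (summability.partial_sum f @ summability.totally) = s.
Proof. by move=> fs; apply: cvg_lim => //; exact: norm_hausdorff. Qed.

Lemma has_sum_unique I (f : I -> K) s t : has_sum f s -> has_sum f t -> s = t.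
Proof. by move=> /has_sum_lim <- /has_sum_lim. Qed.

Lemma eq_has_sum I (f g : I -> K) s : has_sum f s -> f =1 g -> has_sum g s.
Proof. by move=> + /funext <-. Qed.

Lemma has_sumD I (f g : I -> K) s t :
  has_sum f s -> has_sum g t -> has_sum (fun i => f i + g i) (s + t).
Proof.
move=> fs gt; rewrite /has_sum.
rewrite (_ : summability.partial_sum _ =
  summability.partial_sum f \+ summability.partial_sum g); first exact: cvgD.
by apply/funext => J; rewrite /summability.partial_sum big_split.
Qed.

Lemma has_sumZ I (c : K) (f : I -> K) s :
  has_sum f s -> has_sum (fun i => c * f i) (c * s).
Proof.
move=> fs; rewrite /has_sum.
rewrite (_ : summability.partial_sum _ =
  (fun J => c * summability.partial_sum f J)); first exact: cvgMr.
by apply/funext => J; rewrite /summability.partial_sum mulr_sumr.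
Qed.

Arguments has_sumZ [I] c [f s].

Lemma has_sumB I (f g : I -> K) s t :
  has_sum f s -> has_sum g t -> has_sum (fun i => f i - g i) (s - t).
Proof.
move=> fs gt; have := has_sumD fs (has_sumZ (-1) gt).
by rewrite mulN1r => /eq_has_sum; apply => i; rewrite mulN1r.
Qed.

Lemma has_sum_fin I (f : I -> K) (J0 : {fset I}) :
  (forall i, i \notin J0 -> f i = 0) -> has_sum f (\sum_(i <- J0) f i).
Proof.
move=> f0; apply/has_sumP => e e0; exists J0 => J J0J.
suff -> : \sum_(i <- J) f i = \sum_(i <- J0) f i by rewrite subrr normr0.
by apply/esym/big_fset_incl => // i _; exact: f0.
Qed.

Lemma has_sum_reindex I (f g : I -> K) (X : pred I) (h h' : I -> I) s :
  {in X, cancel h h'} -> (forall i, i \in X -> f (h i) = g i) ->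
  (forall i, i \notin X -> g i = 0) ->
  (forall j, f j != 0 -> h' j \in X /\ h (h' j) = j) ->
  has_sum f s -> has_sum g s.
Proof.
move=> hK fg g0 fX /has_sumP fs; apply/has_sumP => e /fs[J0 J0P].
exists [fset h' j | j in J0]%fset => J J0J.
pose J1 := [fset h i | i in [fset i in J | i \in X]]%fset.
suff -> : \sum_(i <- J) g i = \sum_(i <- (J1 `|` J0)%fset) f i.
  by apply: J0P; apply/fsubsetP => j jJ0; rewrite in_fsetU jJ0 orbT.
rewrite -(@big_fset_incl _ _ _ _ J1 (J1 `|` J0)%fset); last first.
- move=> j; rewrite in_fsetU => /orP[->//|jJ0] jJ1; apply/eqP.
  apply: contraNT jJ1 => /fX[h'X h'K]; rewrite -h'K; apply: in_imfset.
  rewrite /= !inE h'X andbT; apply: (fsubsetP J0J).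
  exact: in_imfset.
- by apply/fsubsetP => j jJ1; rewrite in_fsetU jJ1.
rewrite /J1 big_imfset /=; last first.
  move=> i j; rewrite !inE => /andP[_ iX] /andP[_ jX] hij.
  by rewrite -(hK _ iX) hij hK.
rewrite -(@big_fset_incl _ _ _ _ [fset i in J | i \in X]%fset J); last first.
- by move=> i iJ; rewrite !inE iJ /= => /g0.
- by apply/fsubsetP => i; rewrite !inE => /andP[].
rewrite big_seq [RHS]big_seq; apply: eq_bigr => i.
by rewrite !inE => /andP[_ /fg].
Qed.

Lemma has_sum_norm_le I (f : I -> K) s M :
  has_sum f s -> (forall J : {fset I}, \sum_(i <- J) `|f i| <= M) -> `|s| <= M.
Proof.
move=> /has_sumP fs fM; apply/ler_addgt0Pr => e /fs[J0 /(_ J0)].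
move=> /(_ (fsubset_refl _)) J0P.
rewrite -[s](subrK (\sum_(i <- J0) f i)) addrC.
apply: le_trans (ler_normD _ _) _.
apply: lerD; last exact: ltW.
exact: le_trans (ler_norm_sum _ _ _) (fM _).
Qed.

Lemma has_sum_nat (f : nat -> K) s :
  has_sum f s -> \sum_(i < n) f i @[n --> \oo] --> s.
Proof.
move=> /has_sumP fs; apply/cvgrPdist_lt => e /fs[J0 J0P].
(* From this bound on, the initial segment of length [n] contains [J0]. *)
exists (\max_(i <- J0) i.+1)%N => // n /= J0n.
pose J := [fset i in iota 0 n]%fset.
suff -> : \sum_(i < n) f i = \sum_(i <- J) f i.
  apply: J0P; apply/fsubsetP => i iJ0; rewrite !inE mem_iota /= add0n.
  by apply: leq_trans J0n; rewrite (big_rem i) //= leq_maxl.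
rewrite -(big_mkord predT f) /index_iota subn0; apply: perm_big.
apply: uniq_perm => [||i]; rewrite ?iota_uniq ?fset_uniq //.
by rewrite inE.
Qed.

End HasSum.

Arguments has_sumZ {K} [I] c [f s].

(** * Absolute convergence over the reals and the complex numbers *)

Section AbsoluteSummability.
Context {R : realType}.
Implicit Types (I : choiceType).
Local Open Scope complex_scope.

(** Finite partial sums of nonnegative terms grow with the index set, so they converge to their
    supremum. *)
Lemma has_sum_ge0 I (f : I -> R) M :
  (forall i, 0 <= f i) -> (forall J : {fset I}, \sum_(i <- J) f i <= M) ->
  exists s, has_sum f s.
Proof.
move=> f0 fM; pose E := [set \sum_(i <- J) f i | J in [set: {fset I}]].
have Esup : has_sup E.
  split; first by exists (\sum_(i <- fset0) f i), fset0.
  by exists M => _ [J _ <-].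
exists (sup E); apply/has_sumP => e e0.
have [_ [J0 _ <-] J0e] := sup_adherent e0 Esup.
exists J0 => J J0J.
have J0leJ : \sum_(i <- J0) f i <= \sum_(i <- J) f i.
  rewrite [leRHS](big_fsetID _ (mem J0)) /=.
  rewrite (_ : [fset x | x in J & x \in J0]%fset = J0).
    by rewrite lerDl sumr_ge0.
  apply/fsetP => i; rewrite !inE andbC.
  by case: (boolP (i \in J0)) => //= /(fsubsetP J0J).
have JE : \sum_(i <- J) f i <= sup E by apply: sup_upper_bound => //; exists J.
rewrite ger0_norm ?subr_ge0 //; lra.
Qed.

(** The family is the difference of the nonnegative families [|f|] and [|f| - f], whose partial sums
    are at most [M] and [M + M]. *)
Lemma has_sum_abs_real I (f : I -> R) M :
  (forall J : {fset I}, \sum_(i <- J) `|f i| <= M) -> exists s, has_sum f s.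
Proof.
move=> fM; have [s fs] := has_sum_ge0 (fun i => normr_ge0 (f i)) fM.
have [||t ft] := @has_sum_ge0 _ (fun i => `|f i| - f i) (M + M).
- by move=> i; rewrite subr_ge0 ler_norm.
- move=> J; rewrite sumrB lerD // lerNl.
  apply: le_trans (_ : - \sum_(i <- J) `|f i| <= _); first by rewrite lerN2.
  by rewrite -sumrN; apply: ler_sum => i _; rewrite lerNl -normrN ler_norm.
exists (s - t); have /eq_has_sum := has_sumB fs ft; apply=> i; ring.
Qed.

Lemma has_sum_complex I (f : I -> R) s :
  has_sum f s -> has_sum (fun i => (f i)%:C) s%:C.
Proof.
move=> /has_sumP fs; apply/has_sumP => e; rewrite ltcE /= => /andP[/eqP e0 ePos].
have [J0 J0P] := fs _ ePos; exists J0 => J /J0P.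
rewrite -rmorph_sum -rmorphB /= normc_def /= expr0n addr0 sqrtr_sqr.
by rewrite ltcE /= e0 eqxx.
Qed.

Lemma ReIm_le_norm (z : R[i]) : `|complex.Re z|%:C <= `|z| /\ `|complex.Im z|%:C <= `|z|.
Proof.
split; first exact: normc_ge_Re.
by rewrite normc_def lecR -sqrtr_sqr ler_wsqrtr // lerDr sqr_ge0.
Qed.

(** The norm dominates the real and imaginary parts, so the real case applies to each of them. *)
Lemma has_sum_abs I (f : I -> R[i]) (M : R) :
  (forall J : {fset I}, \sum_(i <- J) `|f i| <= M%:C) ->
  exists s, has_sum f s.
Proof.
move=> fM.
have [J|s fs] := @has_sum_abs_real _ (fun i => complex.Re (f i)) M.
  rewrite -lecR; apply: le_trans (fM J); rewrite rmorph_sum.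
  by apply: ler_sum => i _; have [] := ReIm_le_norm (f i).
have [J|t ft] := @has_sum_abs_real _ (fun i => complex.Im (f i)) M.
  rewrite -lecR; apply: le_trans (fM J); rewrite rmorph_sum.
  by apply: ler_sum => i _; have [] := ReIm_le_norm (f i).
exists (s%:C + 'i * t%:C).
have := has_sumD (has_sum_complex fs) (has_sumZ 'i (has_sum_complex ft)).
by move=> /eq_has_sum; apply=> i; rewrite -complexE.
Qed.

End AbsoluteSummability.

(** * Bounds from geometric series *)

Section GeometricBounds.
Context {R : realType}.
Implicit Types (t y c : R).

Lemma sum_expr_le y n : 0 <= y < 1 -> \sum_(i < n) y ^+ i <= (1 - y)^-1.
Proof.
move=> /andP[y0 y1]; have y1' : 0 < 1 - y by rewrite subr_gt0.
rewrite -[leRHS]mul1r ler_pdivlMr // mulrC.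
have -> : (1 - y) * \sum_(i < n) y ^+ i = 1 - y ^+ n.
  by rewrite -opprB mulNr -subrX1 opprB.
by rewrite gerBl exprn_ge0.
Qed.

Lemma sum_fset_expr_le y (J : {fset nat}) :
  0 <= y < 1 -> \sum_(i <- J) y ^+ i <= (1 - y)^-1.
Proof.
move=> y01; have /andP[y0 y1] := y01.
pose n := (\max_(i <- J) i.+1)%N; pose J' := [fset i in iota 0 n]%fset.
apply: le_trans (sum_expr_le n y01).
have -> : \sum_(i < n) y ^+ i = \sum_(i <- J') y ^+ i.
  rewrite -(big_mkord predT (GRing.exp y)) /index_iota subn0; apply: perm_big.
  apply: uniq_perm => [||i]; rewrite ?iota_uniq ?fset_uniq //.
  by rewrite inE.
rewrite [leRHS](big_fsetID _ (mem J)) /=.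
rewrite (_ : [fset x | x in J' & x \in J]%fset = J).
  by rewrite lerDl sumr_ge0 // => i _; exact: exprn_ge0.
apply/fsetP => i; rewrite !inE mem_iota /= add0n andbC.
case: (boolP (i \in J)) => //= iJ.
by rewrite /n (big_rem i) //= leq_maxl.
Qed.

(** Follows from 1 + x <= exp x and the geometric series; the bound is uniform in [n]. *)
Lemma prod_1D_expr_le c t n : 0 <= c -> 0 <= t < 1 ->
  \prod_(i < n) (1 + c * t ^+ i) <= expR (c / (1 - t)).
Proof.
move=> c0 t01; have /andP[t0 t1] := t01.
apply: (@le_trans _ _ (expR (\sum_(i < n) c * t ^+ i))); last first.
  by rewrite ler_expR -mulr_sumr ler_wpM2l // sum_expr_le.
rewrite expR_sum; apply: ler_prod => i _.
by rewrite expR_ge1Dx addr_ge0 // mulr_ge0 // exprn_ge0.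
Qed.

(** Prepares reciprocals for [prod_1D_expr_le]: for y = t^(i+1) the bound reads 1 + c t^i with c = t
    / (1 - t). *)
Lemma inv_1B_le y t : 0 <= y <= t -> t < 1 -> (1 - y)^-1 <= 1 + y / (1 - t).
Proof.
move=> /andP[y0 yt] t1; have y1 := le_lt_trans yt t1.
have -> : (1 - y)^-1 = 1 + y / (1 - y) by field; lra.
by rewrite lerD2l ler_wpM2l // lef_pV2 ?posrE; lra.
Qed.

End GeometricBounds.

(** * Convergence of the q-Pochhammer products *)

Section QPochhammerLimit.
Context {R : realType}.
Implicit Types (q x : R[i]).
Local Open Scope complex_scope.

Lemma norm_complexP q : exists2 t : R, 0 <= t & `|q| = t%:C.
Proof.
exists (complex.Re `|q|); first by rewrite -ler0c RRe_real ?normr_real.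
by rewrite RRe_real ?normr_real.
Qed.

Lemma qpochS (K : numFieldType) (x q : K) n :
  qpoch x q n.+1 = qpoch x q n * (1 - x * q ^+ n).
Proof. by rewrite /qpoch big_ord_recr. Qed.

Lemma qpoch_bounded x q : `|q| < 1 ->
  exists M : R, forall n, `|qpoch x q n| <= M%:C.
Proof.
have [t t0 qt] := norm_complexP q; have [c c0 xc] := norm_complexP x.
rewrite qt -[1]/(1%:C) ltcR => t1.
exists (expR (c / (1 - t))) => n.
apply: (@le_trans _ _ (\prod_(i < n) (1 + c * t ^+ i))%:C); last first.
  by rewrite lecR prod_1D_expr_le ?t0.
rewrite /qpoch normr_prod rmorph_prod; apply: ler_prod => i _.
rewrite normr_ge0 /= (le_trans (ler_normB _ _)) // normr1 normrM normrX xc qt.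
by rewrite rmorphD rmorphM rmorphXn.
Qed.

(** The products telescope into 1 plus the sum of the increments -x q^i (x;q)_i, which is absolutely
    convergent because the (x;q)_i are bounded. *)
Lemma qpoch_cvg x q : `|q| < 1 ->
  qpoch x q n @[n --> \oo] --> qpoch_infty x q.
Proof.
move=> q1; have [M MP] := qpoch_bounded x q1.
have [t t0 qt] := norm_complexP q; have [c c0 xc] := norm_complexP x.
have t1 : t < 1 by rewrite -ltcR -qt.
have M0 : 0 <= M by rewrite -ler0c; apply: le_trans (MP 0%N).
have [J|s fs] := @has_sum_abs R _
  (fun i => - (x * q ^+ i) * qpoch x q i) (c * M / (1 - t)).
  apply: (@le_trans _ _ (\sum_(i <- J) c * M * t ^+ i)%:C); last first.
    by rewrite lecR -mulr_sumr ler_wpM2l ?mulr_ge0 // sum_fset_expr_le ?t0.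
  rewrite rmorph_sum; apply: ler_sum => i _.
  rewrite normrM normrN normrM normrX xc qt mulrAC !rmorphM rmorphXn /=.
  by rewrite ler_wpM2r ?exprn_ge0 ?ler0c // ler_wpM2l ?ler0c.
have qE n : qpoch x q n = 1 + \sum_(i < n) - (x * q ^+ i) * qpoch x q i.
  elim: n => [|n IH]; first by rewrite /qpoch !big_ord0 addr0.
  by rewrite qpochS big_ord_recr /= addrA -IH; ring.
have cvg1 : qpoch x q n @[n --> \oo] --> 1 + s.
  rewrite (_ : qpoch x q = fun n => 1 + \sum_(i < n) - (x * q ^+ i) * qpoch x q i).
    by apply: cvgD; [exact: cvg_cst|exact: has_sum_nat fs].
  exact/funext.
by rewrite /qpoch_infty (cvg_lim _ cvg1) //; exact: norm_hausdorff.
Qed.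

(** Each factor has norm at least 1 - t^(i+1), where t is the norm of q, and the product of the
    reciprocals of these bounds stays bounded. A positive bound uniform in [n] passes to the limit,
    so (q;q)_infinity is nonzero. *)
Lemma qpoch_qq_lower q : `|q| < 1 ->
  exists2 m : R, 0 < m & forall n, m%:C <= `|qpoch q q n|.
Proof.
have [t t0 qt] := norm_complexP q; rewrite qt -[1]/(1%:C) ltcR => t1.
exists (expR (t / (1 - t) / (1 - t)))^-1; first by rewrite invr_gt0 expR_gt0.
have y01 i : 0 <= t ^+ i.+1 <= t.
  by rewrite exprn_ge0 //= exprS ler_piMr // exprn_ile1 // ltW.
move=> n; apply: (@le_trans _ _ (\prod_(i < n) (1 - t ^+ i.+1))%:C); last first.
  rewrite /qpoch normr_prod rmorph_prod; apply: ler_prod => i _.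
  have /andP[yi0 yi1] := y01 i.
  rewrite ler0c subr_ge0 (le_trans yi1 (ltW t1)) andTb -exprS.
  apply: le_trans (lerB_dist _ _).
  by rewrite normr1 normrX qt rmorphB rmorph1 rmorphXn.
rewrite lecR -[leRHS]invrK lef_pV2 ?posrE ?expR_gt0 //; last first.
  rewrite invr_gt0; apply: prodr_gt0 => i _.
  by have /andP[_ yi1] := y01 i; rewrite subr_gt0 (le_lt_trans yi1).
rewrite -prodfV; apply: le_trans (prod_1D_expr_le n _ _); last 2 first.
- by rewrite divr_ge0 // subr_ge0 ltW.
- by rewrite t0.
apply: ler_prod => i _; have /andP[_ yi1] := y01 i.
rewrite invr_ge0 subr_ge0 (le_trans yi1 (ltW t1)) /=.
have := inv_1B_le (y01 i) t1; rewrite exprS; congr (_ <= _ + _).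
by rewrite mulrAC.
Qed.

Lemma qpoch_infty_qq_neq0 q : `|q| < 1 -> qpoch_infty q q != 0.
Proof.
move=> q1; have [m m0 mP] := qpoch_qq_lower q1; apply/eqP => q0.
have := @qpoch_cvg q q q1; rewrite q0 => /cvgrPdist_lt /(_ m%:C).
have -> : 0 < m%:C :> R[i] by rewrite -[0]/(0%:C) ltcR.
move=> /(_ isT)[N _ /(_ N (leqnn N))] /=.
by rewrite sub0r normrN => /(le_lt_trans (mP N)); rewrite ltxx.
Qed.

End QPochhammerLimit.

(** * Inserting and deleting a part *)

Section PartOperations.
Implicit Types (p : overpartition) (x y : nat * bool).

(** An overlined part comes before the non-overlined parts of its value. The order is total and
    antisymmetric, so a sorted list is determined by its multiset. *)
Definition part_ge : rel (nat * bool) :=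
  [rel x y | (y.1 < x.1)%N || (x.1 == y.1) && (y.2 ==> x.2)].

Lemma part_ge_trans : transitive part_ge.
Proof. by move=> [m b] [n c] [k d]; rewrite /part_ge /=; case: b; case: c; case: d; lia. Qed.

Lemma part_ge_anti : antisymmetric part_ge.
Proof.
move=> [m b] [n c]; rewrite /part_ge /= => mn.
have /eqP mE : m == n by lia.
by move: mn; rewrite mE ltnn eqxx; case: b; case: c.
Qed.

Lemma part_ge_total : total part_ge.
Proof. by move=> [m b] [n c]; rewrite /part_ge /=; case: b; case: c; lia. Qed.

(** Trades the positional condition on overlines for a bound on multiplicities: in a sorted list, a
    part of equal value before an overlined part must itself be overlined, hence be a second copy of
    it. *)
Lemma is_overpartitionP (s : seq (nat * bool)) :
  reflect [/\ all [pred x | (0 < x.1)%N] s, sorted part_ge s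
            & forall m, (count_mem (m, true) s <= 1)%N]
          (is_overpartition s).
Proof.
pose C := [rel x y : nat * bool | (y.1 <= x.1)%N && (y.2 ==> (x.1 != y.1))].
have -> : is_overpartition s = all [pred x | (0 < x.1)%N] s && pairwise C s.
  rewrite /is_overpartition /unzip1 sorted_pairwise; last first.
    by move=> m n k /= nm mk; lia.
  by rewrite pairwise_map -pairwise_relI.
rewrite sorted_pairwise; last exact: part_ge_trans.
apply: (iffP andP) => [[s0 sC]|[s0 sge s1]]; split => //.
- apply: sub_pairwise sC => -[m b] [n c]; rewrite /part_ge /=.
  by case: b; case: c; lia.
- move=> m; elim: s sC {s0} => //= x s IH /andP[xs /IH {}IH].
  case: eqP => [xE|_]; last by rewrite add0n.
  suff /count_memPn -> : (m, true) \notin s by [].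
  by apply/negP => /(allP xs); rewrite xE /= eqxx andbF.
- elim: s sge s1 {s0} => //= x s IH /andP[xs /IH {}IH] s1; apply/andP; split.
    apply/allP => y ys; have := allP xs _ ys; rewrite /part_ge /=.
    case: (boolP ((x.1 == y.1) && y.2)) => [/andP[/eqP xy y2]|]; last first.
      by case: (y.2) => /=; lia.
    rewrite xy y2 ltnn eqxx /= => x2; have := s1 y.1.
    have -> : (y.1, true) = y by case: (y) y2 => ? [].
    have -> : x == y by apply/eqP; case: (x) (y) xy x2 y2 => ? [] [? []] //= -> .
    by move: ys; rewrite -has_pred1 has_count /=; case: (count _ _).
  by apply: IH => m; apply: leq_trans (s1 m); rewrite leq_addl.
Qed.

Lemma overpartition_perm_inj p p' : perm_eq p p' -> p = p'.
Proof.
move=> pp'; apply: val_inj => /=.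
have /is_overpartitionP[_ sp _] := valP p.
have /is_overpartitionP[_ sp' _] := valP p'.
exact: (sorted_eq part_ge_trans part_ge_anti sp sp' pp').
Qed.

Lemma weight_perm p (s : seq (nat * bool)) :
  perm_eq p s -> weight p = (\sum_(x <- s) x.1)%N.
Proof. exact: perm_big. Qed.

Definition insertable x p : bool :=
  (0 < x.1)%N && (x.2 ==> (x \notin op_parts p)).

(** The default [p] of [insubd] is avoided as soon as [x] is insertable; in [delete_part] it is
    never reached. *)
Definition insert_part x p : overpartition := insubd p (sort part_ge (x :: p)).

Definition delete_part x p : overpartition := insubd p (rem x p).

Lemma insert_part_perm x p : insertable x p -> perm_eq (insert_part x p) (x :: p).
Proof.
move=> /andP[x0 xp]; rewrite /insert_part [X in perm_eq X]val_insubd.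
rewrite (_ : is_overpartition _) ?perm_sort //.
have /is_overpartitionP[p0 _ p1] := valP p.
apply/is_overpartitionP; split.
- by rewrite all_sort /= x0.
- exact/sort_sorted/part_ge_total.
- move=> m; rewrite count_sort /=; case: eqP => [xE|_]; last by rewrite add0n.
  move: xp; rewrite xE /= => /count_memPn ->.
  by [].
Qed.

Lemma delete_part_val x p : op_parts (delete_part x p) = rem x p.
Proof.
rewrite /delete_part [LHS]val_insubd (_ : is_overpartition _) //.
have /is_overpartitionP[p0 sp p1] := valP p.
have sub := rem_subseq x p; apply/is_overpartitionP; split.
- by apply/allP => y /(mem_subseq sub) /(allP p0).
- exact: subseq_sorted part_ge_trans _ _ sub sp.
- by move=> m; apply: leq_trans (p1 m); exact: leq_count_subseq.
Qed.

Lemma delete_part_perm x p : x \in op_parts p -> perm_eq p (x :: delete_part x p).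
Proof. by move=> xp; rewrite delete_part_val; exact: perm_to_rem. Qed.

Lemma insertable_delete x p : x \in op_parts p -> insertable x (delete_part x p).
Proof.
move=> xp; have /is_overpartitionP[p0 _ p1] := valP p.
rewrite /insertable; have /= -> := allP p0 _ xp; apply/implyP => x2.
have := p1 x.1; rewrite (_ : (x.1, true) = x); last by case: (x) x2 => ? [].
have /permP -> := delete_part_perm xp; rewrite /= eqxx add1n ltnS leqn0.
by move=> /eqP/count_memPn.
Qed.

Lemma insert_partK x p : insertable x p -> delete_part x (insert_part x p) = p.
Proof.
move=> xp; apply: overpartition_perm_inj.
have xip : x \in op_parts (insert_part x p).
  by rewrite (perm_mem (insert_part_perm xp)) mem_head.
rewrite -(perm_cons x) -(permPr (insert_part_perm xp)) perm_sym.
exact: delete_part_perm.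
Qed.

Lemma delete_partK x p : x \in op_parts p -> insert_part x (delete_part x p) = p.
Proof.
move=> xp; apply: overpartition_perm_inj.
rewrite (permPl (insert_part_perm (insertable_delete xp))) perm_sym.
exact: delete_part_perm.
Qed.

Lemma weight_delete x p :
  x \in op_parts p -> weight p = (x.1 + weight (delete_part x p))%N.
Proof. by move=> /delete_part_perm/weight_perm ->; rewrite big_cons. Qed.

Lemma count_insert x y p : insertable x p ->
  count_mem y (insert_part x p) = ((x == y) + count_mem y p)%N.
Proof. by move=> /insert_part_perm/permP ->. Qed.

Lemma count_delete x y p : x \in op_parts p ->
  count_mem y p = ((x == y) + count_mem y (delete_part x p))%N.
Proof. by move=> /delete_part_perm/permP ->. Qed.

Lemma part_le_weight x p : x \in op_parts p -> (x.1 <= weight p)%N.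
Proof. by move=> xp; rewrite [leqRHS]/weight (big_rem _ xp) leq_addr. Qed.

Lemma overpart_gt0 x p : x \in op_parts p -> (0 < x.1)%N.
Proof. by have /is_overpartitionP[p0 _ _] := valP p; move=> /(allP p0). Qed.

End PartOperations.

(** * Summability of t^|p| over all overpartitions *)

Section WeightBound.
Context {R : realType}.
Implicit Types (p : overpartition) (t : R).

Lemma sum_parts_count N (s : seq (nat * bool)) :
  (forall x : nat * bool, x \in s -> 0 < x.1 <= N)%N ->
  (\sum_(x <- s) x.1 =
   \sum_(y : 'I_N * bool) y.1.+1 * count_mem (y.1.+1 : nat, y.2) s)%N.
Proof.
elim: s => [|x s IH] sN.
  by rewrite big_nil big1 // => y _; rewrite muln0.
rewrite big_cons IH; last by move=> y ys; apply: sN; rewrite inE ys orbT.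
have /andP[x0 xN] := sN x (mem_head _ _).
under [RHS]eq_bigr do rewrite /= mulnDr.
rewrite [RHS]big_split /=; congr (_ + _)%N.
have xN' : (x.1.-1 < N)%N by rewrite prednK.
rewrite (bigD1 (Ordinal xN', x.2)) //= prednK // -surjective_pairing eqxx muln1.
rewrite big1 ?addn0 // => -[i b] /= ib; case: eqP => [xE|]; last by rewrite muln0.
case/eqP: ib; congr pair; last by rewrite xE.
by apply: val_inj; rewrite /= xE.
Qed.

Lemma weight_count N p : (weight p <= N)%N ->
  weight p =
  (\sum_(y : 'I_N * bool) y.1.+1 * count_mem (y.1.+1 : nat, y.2) p)%N.
Proof.
move=> pN; apply: sum_parts_count => x xp.
by rewrite (overpart_gt0 xp) (leq_trans (part_le_weight xp)).
Qed.

Lemma size_le_weight p : (size p <= weight p)%N.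
Proof.
rewrite -sum1_size /weight big_seq [leqRHS]big_seq.
by apply: leq_sum => x /overpart_gt0.
Qed.

(** The members of a finite set have weight at most some [N], and each is determined by its
    multiplicities. The sum over all arrays of multiplicities up to [N] factors into geometric sums,
    each at most 1 / (1 - t^m), and their product is bounded independently of [N]. *)
Lemma sum_weight_bounded t : 0 <= t < 1 ->
  exists M, forall J : {fset overpartition}, \sum_(p <- J) t ^+ weight p <= M.
Proof.
move=> t01; have /andP[t0 t1] := t01; pose c := t / (1 - t).
have c0 : 0 <= c by rewrite divr_ge0 // subr_ge0 ltW.
(* The square accounts for the two kinds of part of each value; [c] is the constant produced by
   [inv_1B_le]. *)
exists (expR (c / (1 - t)) ^+ 2) => J.
pose N := (\max_(p <- J) weight p)%N.
have JN p : p \in J -> (weight p <= N)%N.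
  by move=> pJ; rewrite /N (big_rem p) //= leq_maxl.
(* The index i stands for the value i + 1. For members of [J] no multiplicity exceeds [N], because
   the number of parts is at most the weight, so [inord] loses nothing. *)
pose code p := [ffun y : 'I_N * bool =>
  inord (count_mem (y.1.+1 : nat, y.2) p) : 'I_N.+1].
have codeE p y : p \in J -> code p y = count_mem (y.1.+1 : nat, y.2) p :> nat.
  move=> pJ; rewrite ffunE inordK // ltnS (leq_trans (count_size _ _)) //.
  exact: leq_trans (size_le_weight p) (JN p pJ).
pose G (f : {ffun 'I_N * bool -> 'I_N.+1}) := 
    \prod_(y : 'I_N * bool) (t ^+ y.1.+1) ^+ f y.
have -> : \sum_(p <- J) t ^+ weight p = \sum_(f <- map code J) G f.
  rewrite big_map big_seq [RHS]big_seq; apply: eq_bigr => p pJ.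
  rewrite (weight_count (JN p pJ)) expr_sum; apply: eq_bigr => y _.
  by rewrite codeE // exprM.
have code_inj : {in J &, injective code}.
  move=> p p' pJ p'J pp'; apply: overpartition_perm_inj.
  apply/allP => -[m b] _ /=; apply/eqP.
  case: (boolP ((0 < m <= N)%N)) => [/andP[m0 mN]|mN].
    have mN' : (m.-1 < N)%N by rewrite prednK.
    have := codeE p (Ordinal mN', b) pJ; rewrite /= prednK // => <-.
    by rewrite pp' codeE //= prednK.
  have not_in p1 : p1 \in J -> (m, b) \notin op_parts p1.
    move=> p1J; apply: contra mN => mp1; have /= -> := overpart_gt0 mp1.
    exact: leq_trans (part_le_weight mp1) (JN _ p1J).
  by rewrite !(count_memPn _) ?not_in.
have GE0 f : 0 <= G f.
  by apply: prodr_ge0 => y _; rewrite !exprn_ge0.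
(* Arrays that code no member of [J] only add nonnegative terms. *)
apply: (@le_trans _ _ (\sum_f G f)).
  rewrite big_uniq ?map_inj_in_uniq ?fset_uniq //= big_mkcond /=.
  by apply: ler_sum => f _; case: ifP.
rewrite -(bigA_distr_bigA (fun (y : 'I_N * bool) (k : 'I_N.+1) =>
  (t ^+ y.1.+1) ^+ k)) /=.
apply: (@le_trans _ _ (\prod_(y : 'I_N * bool) (1 + c * t ^+ y.1))).
  apply: ler_prod => y _.
  have y01 : 0 <= t ^+ y.1.+1 <= t.
    by rewrite exprn_ge0 //= exprS ler_piMr // exprn_ile1 // ltW.
  have /andP[y0 y1] := y01.
  rewrite sumr_ge0 /=; last by move=> k _; exact: exprn_ge0.
  apply: le_trans (sum_expr_le _ _) _; first by rewrite y0 (le_lt_trans y1).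
  have := inv_1B_le y01 t1; rewrite exprS; congr (_ <= _ + _).
  by rewrite mulrAC.
rewrite -(pair_bigA _ (fun (i : 'I_N) (b : bool) => 1 + c * t ^+ i)) /=.
under eq_bigr do rewrite big_bool /= -expr2.
rewrite prodrXl lerXn2r ?nnegrE ?expR_ge0 ?prod_1D_expr_le //.
by apply: prodr_ge0 => i _; rewrite addr_ge0 // mulr_ge0 // exprn_ge0.
Qed.

End WeightBound.

(** Serves to identify [S] as a quotient of two limits, with [w] an error factor tending to 1. *)
Lemma cvg_proportional (K : numFieldType) (S l m : K) (u v w : nat -> K) :
  u n @[n --> \oo] --> l -> v n @[n --> \oo] --> m ->
  (forall e : K, 0 < e ->
     exists N, forall n, (N <= n)%N -> `|1 - w n| < e) ->
  (forall n, S * u n = w n * v n) -> S * l = m.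
Proof.
move=> ul vm w1 uvw.
have {}w1 : w n @[n --> \oo] --> (1 : K).
  by apply/cvgrPdist_lt => e /w1[N NP]; exists N.
have {}ul : S * u n @[n --> \oo] --> S * l by exact: cvgMr.
have {}vm : w n * v n @[n --> \oo] --> 1 * m by exact: cvgM.
rewrite -[m]mul1r -(cvg_lim (@norm_hausdorff _ _) vm).
rewrite -(cvg_lim (@norm_hausdorff _ _) ul); congr lim.
by under eq_fun do rewrite uvw.
Qed.

(** * Generating functions of classes of overpartitions *)

Section GeneratingFunctions.
Context {R : realType} (q : R[i]).
Hypothesis q1 : `|q| < 1.
Implicit Types (p : overpartition) (P : pred overpartition) (m : nat).
Local Open Scope complex_scope.

Definition has_gf P (s : R[i]) : Prop :=
  has_sum (fun p => if P p then q ^+ weight p else 0) s.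

Lemma has_gf_ex P : exists s, has_gf P s.
Proof.
have [t t0 qt] := norm_complexP q.
have t1 : t < 1 by rewrite -ltcR -qt.
have [M MP] : exists M, forall J : {fset overpartition},
  \sum_(p <- J) t ^+ weight p <= M by apply: sum_weight_bounded; rewrite t0.
apply: (@has_sum_abs _ _ _ M) => J.
apply: (@le_trans _ _ (\sum_(p <- J) t ^+ weight p)%:C); last by rewrite lecR.
rewrite rmorph_sum; apply: ler_sum => p _; case: ifP => _.
  by rewrite normrX qt rmorphXn.
by rewrite normr0 ler0c exprn_ge0.
Qed.

Lemma eq_has_gf P P' s : has_gf P s -> P =1 P' -> has_gf P' s.
Proof. by move=> + PP'; move=> /eq_has_sum; apply => p; rewrite PP'. Qed.

Lemma has_gfID (P Q : pred overpartition) s1 s2 :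
  has_gf (fun p => P p && Q p) s1 -> has_gf (fun p => P p && ~~ Q p) s2 ->
  has_gf P (s1 + s2).
Proof.
move=> h1 h2; have := has_sumD h1 h2 => /eq_has_sum; apply=> p.
by case: (P p); case: (Q p); rewrite /= ?addr0 ?add0r.
Qed.

Lemma has_gfDiff (P Q : pred overpartition) s1 s2 :
  has_gf P s1 -> has_gf (fun p => P p && Q p) s2 ->
  has_gf (fun p => P p && ~~ Q p) (s1 - s2).
Proof.
move=> h1 h2; have := has_sumB h1 h2 => /eq_has_sum; apply=> p.
by case: (P p); case: (Q p); rewrite /= ?subrr ?subr0.
Qed.

(** The two hypotheses make insertion of [x] a bijection from [P'] onto [P], with deletion as its
    inverse; it multiplies every term by q^(x.1). *)
Lemma has_gf_insert x P P' s :
  (forall p, P' p -> insertable x p /\ P (insert_part x p)) ->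
  (forall p, P p -> x \in op_parts p /\ P' (delete_part x p)) ->
  has_gf P' s -> has_gf P (q ^+ x.1 * s).
Proof.
move=> P'P PP' /(has_sumZ (q ^+ x.1)); rewrite /has_gf.
apply: (@has_sum_reindex _ _ _ _ P (delete_part x) (insert_part x)).
- by move=> p /PP'[xp _]; exact: delete_partK.
- move=> p Pp; have [xp P'd] := PP' p Pp.
  by rewrite P'd (_ : P p = true) // (weight_delete xp) exprD.
- by move=> p; rewrite unfold_in => /negbTE ->.
- move=> p; case: ifP => [/P'P[xp Pi] _|_]; last by rewrite mulr0 eqxx.
  by split=> //; exact: insert_partK.
Qed.

(** Independence of the parts of value [m], phrased by multiplicities so that the order of the parts
    does not matter. *)
Definition free_of m P : Prop := forall p p',
  (forall y : nat * bool, y.1 != m -> count_mem y p = count_mem y p') ->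
  P p = P p'.

Lemma free_of_insert m b P p : free_of m P -> insertable (m, b) p ->
  P (insert_part (m, b) p) = P p.
Proof.
move=> PP mp; apply: PP => y ym; rewrite count_insert //.
by have [E|] := eqVneq (m, b) y; first by rewrite -E eqxx in ym.
Qed.

Lemma free_of_delete m b P p : free_of m P -> (m, b) \in op_parts p ->
  P (delete_part (m, b) p) = P p.
Proof.
move=> PP mp; apply: PP => y ym; rewrite [RHS](count_delete _ mp).
by have [E|] := eqVneq (m, b) y; first by rewrite -E eqxx in ym.
Qed.

Lemma has_gf_split m P s : (0 < m)%N -> free_of m P -> has_gf P s ->
  exists s0, [/\ s = (1 + q ^+ m) * s0,
    has_gf (fun p => P p && ((m, true) \in op_parts p)) (q ^+ m * s0)
  & forall j, has_gf (fun p => [&& P p, (m, true) \notin op_parts p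
       & (j <= count_mem (m, false) p)%N]) (q ^+ (m * j) * s0)].
Proof.
move=> m0 PP Ps.
(* Inserting the overlined part turns the class counted by [s0] into its complement in [P], which
   forces s = (1 + q^m) s0. *)
have [s0 s0P] := has_gf_ex (fun p => P p && ((m, true) \notin op_parts p)).
have s1P : has_gf (fun p => P p && ((m, true) \in op_parts p)) (q ^+ m * s0).
  apply: (@has_gf_insert (m, true)) s0P => p /andP[Pp mp].
    have ins : insertable (m, true) p by rewrite /insertable m0.
    split=> //; rewrite free_of_insert // Pp /=.
    by rewrite (perm_mem (insert_part_perm ins)) mem_head.
  split=> //; rewrite free_of_delete // Pp /=.
  by have /andP[] := insertable_delete mp.
exists s0; split; [|exact: s1P|].
  by rewrite mulrDl mul1r addrC (has_sum_unique Ps (has_gfID s1P s0P)).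
(* Each further required copy is one insertion of a non-overlined [m], worth a factor q^m. *)
elim=> [|j IH].
  by rewrite muln0 mul1r; apply: eq_has_gf s0P _ => p; rewrite andbT.
rewrite mulnS exprD -mulrA; apply: (@has_gf_insert (m, false)) IH => p.
  move=> /and3P[Pp mp jp]; have ins : insertable (m, false) p.
    by rewrite /insertable m0.
  split=> //; rewrite free_of_insert // Pp count_insert // eqxx ltnS jp andbT.
  by rewrite (perm_mem (insert_part_perm ins)) inE negb_or mp xpair_eqE andbF.
move=> /and3P[Pp mp jp]; have mfp : (m, false) \in op_parts p.
  by rewrite -has_pred1 has_count (leq_ltn_trans _ jp).
split=> //; rewrite free_of_delete // Pp /=.
move: jp; rewrite (count_delete _ mfp) eqxx ltnS => ->; rewrite andbT.
by rewrite delete_part_val; apply: contra mp; exact: mem_rem.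
Qed.

Lemma expr1D_neq0 m : (0 < m)%N -> 1 + q ^+ m != 0.
Proof.
move=> m0; rewrite addrC addr_eq0; apply/eqP => /(congr1 Num.norm).
rewrite normrX normrN normr1 => qm; have := q1.
by rewrite -(@expr_lt1 _ m) // qm ltxx.
Qed.

Definition part_saturated r m p : bool :=
  ((m, true) \in op_parts p) || (r.-1 <= count_mem (m, false) p)%N.

Lemma has_gf_saturated r m P s : (2 <= r)%N -> (0 < m)%N -> free_of m P ->
  has_gf P s -> has_gf (fun p => P p && part_saturated r m p)
    (s * (q ^+ m * (1 + q ^+ ((r - 2) * m)) / (1 + q ^+ m))).
Proof.
move=> r2 m0 PP /(has_gf_split m0 PP)[s0 [-> s1P sjP]].
have -> : (1 + q ^+ m) * s0 * (q ^+ m * (1 + q ^+ ((r - 2) * m)) / (1 + q ^+ m))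
    = q ^+ m * s0 + q ^+ (m * r.-1) * s0.
  (* The two terms are the disjoint cases: overlined [m] present, or absent with at least r - 1
     plain copies. Here the common factor q^m is split off. *)
  have -> : (m * r.-1 = m + (r - 2) * m)%N by case: r r2 => [|[|r]] // _; lia.
  by rewrite exprD; field; exact: expr1D_neq0.
apply: (@has_gfID _ (fun p => (m, true) \in op_parts p)).
  apply: eq_has_gf s1P _ => p; rewrite /part_saturated -andbA.
  by congr andb; case: (_ \in _); rewrite ?andbF ?andbT.
apply: eq_has_gf (sjP r.-1) _ => p; rewrite /part_saturated -andbA.
by congr andb; case: (_ \in _); rewrite ?andbF ?andbT.
Qed.

(** Among the overpartitions without overlined [m], those with at least one plain copy are
    subtracted, leaving (1 - q^m) s0. *)
Lemma has_gf_omit m P s : (0 < m)%N -> free_of m P -> has_gf P s ->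
  has_gf (fun p => [&& P p, (m, true) \notin op_parts p
                     & (m, false) \notin op_parts p])
    (s * ((1 - q ^+ m) / (1 + q ^+ m))).
Proof.
move=> m0 PP /(has_gf_split m0 PP)[s0 [-> _ sjP]].
have -> : (1 + q ^+ m) * s0 * ((1 - q ^+ m) / (1 + q ^+ m))
    = q ^+ (m * 0) * s0 - q ^+ (m * 1) * s0.
  by rewrite muln0 muln1; field; exact: expr1D_neq0.
have := has_gfDiff (sjP 0%N) (Q := fun p => (m, false) \in op_parts p).
move=> /(_ (q ^+ (m * 1) * s0)) h; apply: eq_has_gf (h _) _.
  apply: eq_has_gf (sjP 1%N) _ => p.
  by rewrite -has_count has_pred1 andbT -andbA.
by move=> p; rewrite andbT -andbA.
Qed.

Definition parts_gt N p : bool := all [pred x | (N < x.1)%N] (op_parts p).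

Lemma parts_gtS N p : parts_gt N.+1 p =
  [&& parts_gt N p, (N.+1, true) \notin op_parts p
    & (N.+1, false) \notin op_parts p].
Proof.
apply/idP/and3P => [h|[h hT hF]].
  split; last 2 first.
  - by apply/negP => /(allP h) /=; rewrite ltnn.
  - by apply/negP => /(allP h) /=; rewrite ltnn.
  by apply/allP => x /(allP h) /= /ltnW.
apply/allP => x xp /=; have /= := allP h _ xp.
rewrite leq_eqVlt => /orP[/eqP Nx|//].
by case: x xp Nx => m [] /= + Nx; rewrite -Nx ?(negbTE hT) ?(negbTE hF).
Qed.

Lemma parts_gt_free N : free_of N.+1 (parts_gt N).
Proof.
suff imp p p' : (forall y : nat * bool, y.1 != N.+1 ->
    count_mem y p = count_mem y p') -> parts_gt N p -> parts_gt N p'.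
  by move=> p p' pp'; apply/idP/idP; apply: imp => // y /pp' ->.
move=> pp' /allP pN; apply/allP => x xp' /=.
have [->//|/eqP xN] := altP (x.1 =P N.+1).
apply: (pN x); rewrite -has_pred1 has_count pp'; last exact/eqP.
by rewrite -has_count has_pred1.
Qed.

Lemma has_gf_parts_gt S N : has_gf predT S ->
  has_gf (parts_gt N) (S * (qpoch q q N / qpoch (- q) q N)).
Proof.
move=> ST; elim: N => [|N IH].
  rewrite /qpoch !big_ord0 divr1 mulr1; apply: eq_has_gf ST _ => p.
  by apply/esym/allP => x /overpart_gt0.
have := has_gf_omit (ltn0Sn N) (@parts_gt_free N) IH => /eq_has_gf.
rewrite !qpochS mulNr opprK -!exprS invfM -!mulrA => h.
have -> : S * (qpoch q q N * ((1 - q ^+ N.+1) * ((qpoch (- q) q N)^-1 / (1 + q ^+ N.+1))))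
  = S * (qpoch q q N * ((qpoch (- q) q N)^-1 * ((1 - q ^+ N.+1) / (1 + q ^+ N.+1)))).
  by ring.
by apply: h => p; rewrite parts_gtS.
Qed.

(** The difference from 1 counts nonempty overpartitions with all parts above [N], whose weight is
    at least [N]. Writing t = u^2, one factor u^|p| ensures summability and the other is at most
    u^N. *)
Lemma gf_parts_gt_near1 S : has_gf predT S -> forall e : R[i], 0 < e ->
  exists N0, forall N, (N0 <= N)%N ->
    `|1 - S * (qpoch q q N / qpoch (- q) q N)| < e.
Proof.
move=> ST; have [t t0 qt] := norm_complexP q.
have t1 : t < 1 by rewrite -ltcR -qt.
pose u := Num.sqrt t; have u0 : 0 <= u := sqrtr_ge0 t.
have uu : u * u = t by rewrite -expr2 sqr_sqrtr.
have u1 : u < 1 by rewrite -(@expr_lt1 _ 2) // expr2 uu.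
have [M MP] : exists M, forall J : {fset overpartition},
  \sum_(p <- J) u ^+ weight p <= M by apply: sum_weight_bounded; rewrite u0.
pose op0 := @Overpartition [::] isT.
have gP N : `|S * (qpoch q q N / qpoch (- q) q N) - 1| <= (M * u ^+ N)%:C.
  (* The constant 1 is the contribution of the empty overpartition. *)
  have h0 : has_sum (fun p => if p == op0 then 1 else 0 : R[i]) 1.
    have := @has_sum_fin R[i] overpartition
      (fun p => if p == op0 then 1 else 0) [fset op0]%fset.
    rewrite big_seq_fset1 eqxx; apply => p.
    by rewrite inE => /negbTE ->.
  have := has_sumB (@has_gf_parts_gt S N ST) h0 => /has_sum_norm_le; apply => J.
  apply: (@le_trans _ _ (\sum_(p <- J) u ^+ weight p * u ^+ N)%:C); last first.
    by rewrite lecR -mulr_suml ler_wpM2r // exprn_ge0.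
  rewrite rmorph_sum; apply: ler_sum => p _.
  have uw0 : 0 <= (u ^+ weight p * u ^+ N)%:C :> R[i].
    by rewrite ler0c mulr_ge0 // exprn_ge0.
  case: eqP => [->|p0].
    rewrite /parts_gt /= /weight big_nil subrr normr0 //.
    by rewrite ler0c mulr_ge0 // exprn_ge0.
  rewrite subr0; case: ifP => [pN|_]; last by rewrite normr0.
  rewrite normrX qt -rmorphXn lecR -uu exprMn ler_wpM2l ?exprn_ge0 //.
  apply: ler_wiXn2l; [exact: u0|exact: ltW|].
  case pE : (op_parts p) pN => [|x s] pN; first by case: p0; apply: val_inj.
  apply: (@leq_trans x.1); last by apply: part_le_weight; rewrite pE mem_head.
  by have := allP pN x; rewrite pE mem_head => /(_ isT) /ltnW.
move=> e; rewrite ltcE /= => /andP[/eqP e0 ePos].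
have : M * u ^+ N @[N --> \oo] --> M * 0.
  by apply: cvgMr; apply: cvg_expr; rewrite ger0_norm.
rewrite mulr0 => /cvgrPdist_lt /(_ _ ePos)[N0 _ N0P]; exists N0 => N /N0P /=.
rewrite sub0r normrN => uNe; rewrite distrC; apply: le_lt_trans (gP N) _.
by rewrite ltcE /= e0 eqxx (le_lt_trans (ler_norm _)).
Qed.

Lemma has_gf_all : has_gf predT (qpoch_infty (- q) q / qpoch_infty q q).
Proof.
have [S ST] := has_gf_ex predT.
suff -> : qpoch_infty (- q) q / qpoch_infty q q = S by [].
have qoo0 := qpoch_infty_qq_neq0 q1.
apply: (mulIf qoo0); rewrite divfK //.
(* The error factor is S (q;q)_N / (-q;q)_N, the generating function for parts above [N]. *)
apply/esym; apply: cvg_proportional (@qpoch_cvg R q q q1)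
  (@qpoch_cvg R (- q) q q1) (gf_parts_gt_near1 ST) _ => N.
rewrite -mulrA divfK //; apply/prodf_neq0 => i _.
by rewrite mulNr opprK -exprS expr1D_neq0.
Qed.

End GeneratingFunctions.

(** * The distribution of [mes] *)

Section MesCoefficients.
Context {R : realType} (A a r : nat) (q : R[i]).
Hypotheses (a0 : (1 <= a)%N) (aA : (a <= A)%N) (r2 : (2 <= r)%N).
Hypothesis q1 : `|q| < 1.
Implicit Types (p : overpartition).

Let A0 : (0 < A)%N := leq_trans a0 aA.

Definition saturated_upto k p : bool :=
  all (fun i => part_saturated r (i * A + a) p) (iota 0 k).

(** The product of the relative weights of m = iA + a for i < k; the exponent A C(k,2) + ka is the
    sum of these m. *)
Definition mes_ratio k : R[i] :=
  q ^+ (A * 'C(k, 2) + k * a) / qpoch (- q ^+ a) (q ^+ A) k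
    * qpoch (- q ^+ ((r - 2) * a)) (q ^+ ((r - 2) * A)) k.

Lemma saturated_uptoS k p : saturated_upto k.+1 p =
  saturated_upto k p && part_saturated r (k * A + a) p.
Proof. by rewrite /saturated_upto -[k.+1]addn1 iotaD all_cat /= add0n andbT. Qed.

(** Since A > 0, the values iA + a with i < k all differ from kA + a; this lets the weights
    multiply. *)
Lemma saturated_upto_free k : free_of (k * A + a) (saturated_upto k).
Proof.
move=> p p' pp'; apply: eq_in_all => i; rewrite mem_iota /= add0n => ik.
have ne : (i * A + a != k * A + a)%N.
  by rewrite eqn_add2r eqn_pmul2r // neq_ltn ik.
rewrite /part_saturated -!has_pred1 !has_count.
by rewrite (pp' (_, true)) // (pp' (_, false)).
Qed.

Lemma mes_ratioS k : mes_ratio k.+1 = mes_ratio k *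
  (q ^+ (k * A + a) * (1 + q ^+ ((r - 2) * (k * A + a))) / (1 + q ^+ (k * A + a))).
Proof.
rewrite /mes_ratio !qpochS binS bin1 invfM !mulNr !opprK.
rewrite -!exprM -!exprD.
have -> : (a + A * k = k * A + a)%N by lia.
have -> : ((r - 2) * a + (r - 2) * A * k = (r - 2) * (k * A + a))%N by lia.
have -> : (A * ('C(k, 2) + k) + k.+1 * a = A * 'C(k, 2) + k * a + (k * A + a))%N.
  by lia.
by rewrite [in LHS]exprD; ring.
Qed.

Lemma has_gf_saturated_upto k : has_gf q (saturated_upto k)
  (qpoch_infty (- q) q / qpoch_infty q q * mes_ratio k).
Proof.
elim: k => [|k IH].
  rewrite /mes_ratio /qpoch !big_ord0 bin0n muln0 mul0n divr1 !mulr1.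
  exact: has_gf_all.
have m0 : (0 < k * A + a)%N by rewrite addn_gt0 a0 orbT.
rewrite mes_ratioS [X in has_gf _ _ X]mulrA.
have h := has_gf_saturated q1 r2 m0 (@saturated_upto_free k) IH.
apply: (eq_has_gf h) => p; by rewrite saturated_uptoS.
Qed.

Lemma mes_pred_saturated p k :
  mes_pred r A a p (k * A + a)%N = ~~ part_saturated r (k * A + a) p.
Proof.
rewrite /mes_pred /part_saturated modnMDl eqxx addn_gt0 a0 orbT negb_or.
by rewrite -ltnNge.
Qed.

Lemma mes_progression p : exists k, mes r A a p = (k * A + a)%N.
Proof.
have [/and4P[m0 /eqP mA _ _] _] := mesP a p A0 r2.
set m := mes _ _ _ _ in m0 mA *.
have am : (a <= m)%N.
  rewrite leqNgt; apply/negP => ma; move: mA.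
  (* An m below a is its own residue: if a < A this gives m = a, and if a = A it gives m = 0, both
     impossible. *)
  rewrite modn_small; last exact: leq_trans ma aA.
  case: (ltngtP a A) aA => // [aA'|->] _; last by rewrite modnn => E; rewrite E in m0.
  by rewrite modn_small // => E; rewrite E ltnn in ma.
exists ((m - a) %/ A)%N; rewrite divnK ?subnK //.
by rewrite -eqn_mod_dvd //; apply/eqP.
Qed.

Lemma mes_eq p k : (mes r A a p == k * A + a)%N =
  saturated_upto k p && ~~ part_saturated r (k * A + a) p.
Proof.
have [mp mmin] := mesP a p A0 r2; apply/eqP/andP => [mk|[sat nsat]].
  rewrite -mes_pred_saturated -mk; split=> //.
  apply/allP => i; rewrite mem_iota /= add0n => ik; apply/negPn/negP.
  rewrite -mes_pred_saturated => /mmin; rewrite mk.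
  by rewrite leq_add2r leq_pmul2r // leqNgt ik.
have [k' k'E] := mes_progression p; rewrite k'E; congr (_ * A + a)%N.
move: mp; rewrite k'E mes_pred_saturated => nsat'.
(* Minimality of [mes] gives k' <= k; conversely all values before index k are saturated and the one
   at k' is not. *)
apply/eqP; rewrite eqn_leq; apply/andP; split.
  move: nsat; rewrite -mes_pred_saturated => /mmin; rewrite k'E.
  by rewrite leq_add2r leq_pmul2r.
rewrite leqNgt; apply: contra nsat' => k'k; apply: (allP sat).
by rewrite mem_iota.
Qed.

Lemma has_gf_mes_eq k : has_gf q (fun p => (k * A + a)%N == mes r A a p)
  (qpoch_infty (- q) q / qpoch_infty q q * (mes_ratio k - mes_ratio k.+1)).
Proof.
rewrite mulrBr.
have h := eq_has_gf (@has_gf_saturated_upto k.+1) (saturated_uptoS k).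
apply: (eq_has_gf (has_gfDiff (@has_gf_saturated_upto k) h)) => p.
by rewrite eq_sym mes_eq.
Qed.

End MesCoefficients.

Theorem theorem2p8 (R : realType) (A a r : nat) (q : R[i])
    (ha : (1 <= a)%N) (haA : (a <= A)%N) (hr : (2 <= r)%N)
    (hq : `|q| < 1) :
  let lhs := fun p : overpartition => zmonom (q ^+ weight p) (mes r A a p) in
  let rhs := fun k : nat =>
    zmonom
      (q ^+ (A * 'C(k, 2) + k * a) / qpoch (- q ^+ a) (q ^+ A) k
         * qpoch (- q ^+ ((r - 2) * a)) (q ^+ ((r - 2) * A)) k
       - q ^+ (A * 'C(k.+1, 2) + k.+1 * a) / qpoch (- q ^+ a) (q ^+ A) k.+1
         * qpoch (- q ^+ ((r - 2) * a)) (q ^+ ((r - 2) * A)) k.+1)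
      (k * A + a)%N in
  [/\ zsummable lhs,
      zsummable rhs
    & zsum lhs = zscale (qpoch_infty (- q) q / qpoch_infty q q) (zsum rhs)].
Proof.
move=> lhs rhs; have A0 : (0 < A)%N := leq_trans ha haA.
(* All three claims are read off one coefficient of z at a time. *)
suff coef n : exists s, has_sum (rhs ^~ n) s /\
    has_sum (lhs ^~ n) (qpoch_infty (- q) q / qpoch_infty q q * s).
  split.
  - by move=> n; have [s [_ hs]] := coef n; exact: has_sum_cvg hs.
  - by move=> n; have [s [hs _]] := coef n; exact: has_sum_cvg hs.
  - apply/funext => n; have [s [hr' hl]] := coef n.
    by rewrite /zsum /zscale (has_sum_lim hr') (has_sum_lim hl).
case: (pselect (exists k, n = k * A + a)%N) => [[k ->]|nk].
  (* As A > 0, only the index k of the right-hand family contributes to the exponent kA + a. *)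
  exists (mes_ratio A a r q k - mes_ratio A a r q k.+1); split.
    have := @has_sum_fin _ _ (rhs ^~ (k * A + a)%N) [fset k]%fset.
    rewrite big_seq_fset1 /rhs /zmonom eqxx; apply=> i.
    by rewrite inE eqn_add2r eqn_pmul2r // eq_sym => /negbTE ->.
  exact: has_gf_mes_eq.
(* Off the progression both families vanish termwise. *)
exists 0; rewrite mulr0; split.
  have := @has_sum_fin _ _ (rhs ^~ n) fset0; rewrite big_seq_fset0; apply=> i _.
  by rewrite /rhs /zmonom; case: eqP => // nE; case: nk; exists i.
have := @has_sum_fin _ _ (lhs ^~ n) fset0; rewrite big_seq_fset0; apply=> p _.
rewrite /lhs /zmonom; case: eqP => // nE; case: nk.
by have [k kE] := mes_progression ha haA hr p; exists k; rewrite nE.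
Qed.
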